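(* Let $X$ be a locally 1-connected metric space and let $A_1,A_2,\dots,A_n$ be connected, locally path connected and compact pairwise disjoint subspaces of $X$. Then the quotient space $X/(A_1,A_2,\dots,A_n)$ is locally 1-connected.
   Context: For pairwise disjoint subspaces $A_1,\dots,A_n$ of a topological space $X$, $X/(A_1,\dots,A_n)$ denotes the quotient space (with the quotient topology) obtained from $X$ by identifying each of the sets $A_i$ to a point (a separate point for each $i$). A topological space $Y$ is locally 1-connected if it is locally path connected and locally simply connected, where locally simply connected means: for every $y\in Y$ and every open neighborhood $U$ of $y$ there is an open neighborhood $V\subseteq U$ of $y$ such that every loop in $V$ is nullhomotopic (relative to endpoints) in $U$. *)

(* Defs.v *)
From HB Require Import structures.
From mathcomp Require Import all_boot all_order all_algebra generic_quotient.
From mathcomp Require Import all_classical all_reals all_analysis.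

Set Implicit Arguments.
Unset Strict Implicit.
Unset Printing Implicit Defensive.

Import Order.TTheory GRing.Theory Num.Theory.
Import numFieldNormedType.Exports.

Local Open Scope classical_set_scope.
Local Open Scope ring_scope.

Section local_connectivity.
Context (R : realType) (Y : topologicalType).
Implicit Types (U V : set Y) (x y : Y).

(* Paths are total functions on R of which only the restriction to [0, 1]
   matters. *)
Definition is_path U x y (f : R -> Y) : Prop :=
  [/\ {within `[0, 1], continuous f},
      (forall t, t \in `[0, 1] -> U (f t)), f 0 = x & f 1 = y].

Definition path_connected U : Prop :=
  forall x y, U x -> U y -> exists f, is_path U x y f.

Definition locally_path_connected : Prop :=
  forall y U, open U -> U y ->
    exists V, [/\ open V, V y, V `<=` U & path_connected V].

(* H (s, t) is the position at parameter s of the path at time t. *)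
Definition path_homotopic U (f g : R -> Y) : Prop :=
  exists H : R * R -> Y,
    [/\ {within `[0, 1] `*` `[0, 1], continuous H},
        (forall s t, s \in `[0, 1] -> t \in `[0, 1] -> U (H (s, t))),
        (forall s, s \in `[0, 1] -> H (s, 0) = f s /\ H (s, 1) = g s) &
        (forall t, t \in `[0, 1] -> H (0, t) = f 0 /\ H (1, t) = f 1)].

Definition nullhomotopic U (f : R -> Y) : Prop :=
  path_homotopic U f (cst (f 0)).

Definition locally_simply_connected : Prop :=
  forall y U, open U -> U y ->
    exists V, [/\ open V, V y, V `<=` U &
      forall x f, is_path V x x f -> nullhomotopic U f].

Definition locally_1_connected : Prop :=
  locally_path_connected /\ locally_simply_connected.

End local_connectivity.

Arguments locally_path_connected R Y : clear implicits.
Arguments locally_simply_connected R Y : clear implicits.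
Arguments locally_1_connected R Y : clear implicits.

Section collapse.
Local Open Scope quotient_scope.
Context (X : topologicalType) (I : Type) (A : I -> set X).
Hypothesis dA : trivIset [set: I] A.

Let collapse_rel' (x y : X) : bool :=
  `[< x = y \/ exists i, A i x /\ A i y >].

Let collapse_rel_refl : reflexive collapse_rel'.
Proof. by move=> x; apply/asboolP; left. Qed.

Let collapse_rel_sym : symmetric collapse_rel'.
Proof.
by move=> x y; apply/asboolP/asboolP => -[->|[i []]];
  [left|right; exists i|left|right; exists i].
Qed.

Let collapse_rel_trans : transitive collapse_rel'.
Proof.
move=> y x z /asboolP[->//|[i [Ax Ay]]] /asboolP[<-|[j [Ay' Az]]].
  by apply/asboolP; right; exists i.
apply/asboolP; right; exists i; split=> //.
by rewrite (dA (i := i) (j := j)) //; exists y.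
Qed.

Definition collapse_rel : equiv_rel X :=
  EquivRel _ collapse_rel_refl collapse_rel_sym collapse_rel_trans.

(* The quotient space X/(A_i)_i; an empty A_i has no effect. *)
Definition collapse := {eq_quot collapse_rel}.

HB.instance Definition _ :=
  Topological.copy collapse (quotient_topology collapse).
HB.instance Definition _ := Quotient.on collapse.

End collapse.

(* Main.v *)
Require Import Defs.
From HB Require Import structures.
From mathcomp Require Import all_boot all_order all_algebra generic_quotient.
From mathcomp Require Import all_classical all_reals all_analysis.
From mathcomp Require Import ring lra zify.
Set Implicit Arguments.
Unset Strict Implicit.
Unset Printing Implicit Defensive.
Import Order.TTheory GRing.Theory Num.Theory.
Import numFieldNormedType.Exports.
Local Open Scope classical_set_scope.
Local Open Scope ring_scope.

(* Only local simple connectedness at the image [a] of some [A_i] is not routine.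
   A loop [f] near [a] lifts to [X] outside the closed set [C = f^-1(a)]. Split
   the complement of [C] into maximal dyadic intervals [J] on which the diameter
   of the lift is less than its distance to [A_i], and join every point [x] near
   [A_i] to [A_i] by a path [c_x] whose size tends to 0 as [x] tends to [A_i].
   For [J = [u, v]], the lift of [f] on [J] together with [c_(f u)], [c_(f v)] and
   a short path in [A_i] joining the ends of these two is a small loop, which
   bounds a small square in [X]. In the quotient the top sides of these squares
   become [a]; the squares fit together along the [c_x], and they shrink towards
   [C], so that setting the value to be [a] over [C] gives a free homotopy from
   [f] to a constant. *)

(** * Gluing continuous maps, and the retraction of the line onto [0, 1] *)

Lemma continuous_pair (T Z1 Z2 : topologicalType) (f : T -> Z1) (g : T -> Z2) :
  continuous f -> continuous g -> continuous (fun x => (f x, g x)).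
Proof. by move=> cf cg x; apply: cvg_pair; [exact: cf|exact: cg]. Qed.

Lemma continuous_compT (T Z1 Z2 : topologicalType) (f : T -> Z1) (g : Z1 -> Z2) :
  continuous f -> continuous g -> continuous (fun x => g (f x)).
Proof. by move=> cf cg x; apply: continuous_comp; [exact: cf|exact: cg]. Qed.

Section clamp.
Context {R : realType}.
Implicit Types (s t : R).

Lemma continuous_at_glue (T Z : topologicalType) (h : T -> R) (f g : T -> Z) x :
  {for x, continuous h} -> {for x, continuous f} -> {for x, continuous g} ->
  (h x = 0 -> f x = g x) ->
  {for x, continuous (fun y => if h y <= 0 then f y else g y)}.
Proof.
move=> ch cf cg fg B /=; have [hx|hx|hx] := ltgtP (h x) 0 => nB;
  change (\forall y \near x, B (if h y <= 0 then f y else g y)).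
- have h0 : \forall y \near x, h y < 0 by exact: (ch _ (lt_nbhsl hx)).
  by apply: filterS2 h0 (cf _ nB) => y hy By; rewrite ifT// ltW.
- have h0 : \forall y \near x, 0 < h y by exact: (ch _ (lt_nbhsr hx)).
  by apply: filterS2 h0 (cg _ nB) => y hy By; rewrite leNgt hy.
- have gB : nbhs (g x) B by rewrite -fg.
  have fy : \forall y \near x, B (f y) by exact: cf.
  have gy : \forall y \near x, B (g y) by exact: cg.
  by apply: filterS2 fy gy => y fB gyB; case: ifP.
Qed.

Lemma continuous_glue (T Z : topologicalType) (h : T -> R) (f g : T -> Z) :
  continuous h -> continuous f -> continuous g ->
  (forall x, h x = 0 -> f x = g x) ->
  continuous (fun x => if h x <= 0 then f x else g x).
Proof.
move=> ch cf cg fg x.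
by apply: continuous_at_glue (fg x); [apply: ch|apply: cf|apply: cg].
Qed.

Lemma continuous_minr (T : topologicalType) (f g : T -> R) :
  continuous f -> continuous g -> continuous (fun x => Num.min (f x) (g x)).
Proof.
move=> cf cg.
have -> : (fun x => Num.min (f x) (g x)) = fun x => if f x - g x <= 0 then f x else g x.
  by apply/funext => x; rewrite subr_le0; case: leP.
apply: continuous_glue => //; last by move=> x /eqP; rewrite subr_eq0 => /eqP.
by move=> x; apply: cvgB; [exact: cf|exact: cg].
Qed.

Lemma continuous_addr (T : topologicalType) (f g : T -> R) :
  continuous f -> continuous g -> continuous (fun x => f x + g x).
Proof. by move=> cf cg x; apply: cvgD; [exact: cf|exact: cg]. Qed.

Lemma continuous_oppr (T : topologicalType) (f : T -> R) :
  continuous f -> continuous (fun x => - f x).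
Proof. by move=> cf x; apply: cvgN; exact: cf. Qed.

Lemma continuous_mulr (T : topologicalType) (f g : T -> R) :
  continuous f -> continuous g -> continuous (fun x => f x * g x).
Proof. by move=> cf cg x; apply: cvgM; [exact: cf|exact: cg]. Qed.

(** Both tests compare with 0 so that [continuous_glue] applies; [path_cat] is written in the same
    way. *)
Definition clamp t : R := if t <= 0 then 0 else if t - 1 <= 0 then t else 1.

Lemma clamp_itv t : 0 <= clamp t <= 1.
Proof. by rewrite /clamp; do 2?case: ifPn; rewrite -?ltNge => *; apply/andP; split; lra. Qed.

Lemma clamp_in t : clamp t \in `[0, 1].
Proof. by rewrite in_itv; exact: clamp_itv. Qed.

Lemma clampK t : 0 <= t <= 1 -> clamp t = t.
Proof. by move=> /andP[? ?]; rewrite /clamp; do 2?case: ifPn; rewrite -?ltNge => *; lra. Qed.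

Lemma clamp_le0 t : t <= 0 -> clamp t = 0.
Proof. by rewrite /clamp => ->. Qed.

Lemma clamp_ge1 t : 1 <= t -> clamp t = 1.
Proof. by move=> ?; rewrite /clamp; do 2?case: ifPn; rewrite -?ltNge => *; lra. Qed.

Lemma continuous_clamp : continuous clamp.
Proof.
apply: continuous_glue => [t|t||t ->];
  [exact: cvg_id|exact: cvg_cst| |by rewrite sub0r lerN10].
apply: continuous_glue => [t|t|t|t]; [|exact: cvg_id|exact: cvg_cst|lra].
by apply: cvgB; [exact: cvg_id|exact: cvg_cst].
Qed.

Lemma continuous_clamp_comp (T : topologicalType) (f : T -> R) :
  continuous f -> continuous (fun x => clamp (f x)).
Proof. by move=> cf; apply: continuous_compT continuous_clamp. Qed.

End clamp.

Ltac continuity := repeat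
  lazymatch goal with
  | |- continuous ?f => lazymatch f with
    | (fun w => (_, _)) => apply: continuous_pair
    | (fun w => clamp _) => apply: continuous_clamp_comp
    | @clamp _ => exact: continuous_clamp
    | (fun w => _ + _) => apply: continuous_addr
    | (fun w => - _) => apply: continuous_oppr
    | (fun w => _ * _) => apply: continuous_mulr
    | (fun w => Num.min _ _) => apply: continuous_minr
    | @fst _ _ => move=> ?; exact: cvg_fst
    | @snd _ _ => move=> ?; exact: cvg_snd
    | (fun w => w) => move=> ?; exact: cvg_id
    | (fun w => _) => move=> ?; exact: cvg_cst
    end
  end.

(** * Paths and nullhomotopies prolonged beyond [0, 1] *)

Section paths.
Context {R : realType} {Z : topologicalType}.
Implicit Types (U : set Z) (x y z : Z) (p q f : R -> Z).

(** With [r] a clamp, this turns continuity on [0, 1] or on its square into continuity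
    everywhere. *)
Lemma continuous_within_comp (T S : topologicalType) (D : set T) (r : S -> T) (f : T -> Z) :
  continuous r -> (forall s, D (r s)) -> {within D, continuous f} ->
  continuous (f \o r).
Proof.
move=> cr rD /subspace_continuousP cf s B nB.
have /(_ B nB) := cf _ (rD s); rewrite /within /= => nD.
have nr : \forall y \near s, D (r y) -> B (f (r y)) by exact: (cr s _ nD).
by apply: filterS nr => y; apply; exact: rD.
Qed.

(* A path prolonged by constants, which spares the restrictions to [0, 1]. *)
Definition total_path U x y p :=
  [/\ continuous p, (forall t, U (p t)), (forall t : R, t <= 0 -> p t = x) &
      (forall t : R, 1 <= t -> p t = y)].

Lemma total_path_clamp U x y f : is_path U x y f -> total_path U x y (f \o clamp).
Proof.
move=> [cf Uf f0 f1]; split.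
- apply: continuous_within_comp cf; first exact: continuous_clamp.
  by move=> t; exact: clamp_in.
- by move=> t; apply: Uf; exact: clamp_in.
- by move=> t t0; rewrite /= clamp_le0.
- by move=> t t0; rewrite /= clamp_ge1.
Qed.

Lemma total_path_is_path U x y p : total_path U x y p -> is_path U x y p.
Proof.
move=> [cf Uf f0 f1]; split; [exact: continuous_subspaceT|by []|exact: f0|exact: f1].
Qed.

Lemma total_path_sub U V x y p : U `<=` V -> total_path U x y p -> total_path V x y p.
Proof. by move=> UV [? Up ? ?]; split => // t; apply/UV/Up. Qed.

Definition path_cat p q t : Z :=
  if t - 2^-1 <= 0 then p (2 * t) else q (2 * t - 1).

Lemma continuous_affine (a b : R) : continuous (fun t : R => a * t + b).
Proof.
move=> t; apply: cvgD; last exact: cvg_cst.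
by apply: cvgM; [exact: cvg_cst|exact: cvg_id].
Qed.

Lemma total_path_cat U x y z p q : total_path U x y p -> total_path U y z q ->
  total_path U x z (path_cat p q).
Proof.
move=> [cp Up p0 p1] [cq Uq q0 q1]; split.
- apply: continuous_glue.
  + by move=> t; apply: cvgB; [exact: cvg_id|exact: cvg_cst].
  + apply: continuous_compT cp => t.
    by apply: cvgM; [exact: cvg_cst|exact: cvg_id].
  + by apply: continuous_compT cq; exact: continuous_affine.
  + by move=> t t0; rewrite p1 ?q0//; lra.
- by move=> t; rewrite /path_cat; case: ifP.
- by move=> t t0; rewrite /path_cat ifT ?p0//; lra.
- by move=> t t0; rewrite /path_cat ifF ?q1//; [lra|apply/negbTE; rewrite -ltNge; lra].
Qed.

Lemma total_path_rev U x y p : total_path U x y p -> total_path U y x (fun t => p (1 - t)).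
Proof.
move=> [cp Up p0 p1]; split => //.
- apply: continuous_compT cp => t; apply: cvgB; [exact: cvg_cst|exact: cvg_id].
- by move=> t t0; rewrite p1//; lra.
- by move=> t t0; rewrite p0//; lra.
Qed.

(** Clamping both coordinates prolongs the homotopy by its boundary values, so that later
    reparametrizations may overshoot the square. *)
Lemma total_nullhomotopy U x p : total_path U x x p -> nullhomotopic U p ->
  exists N : R * R -> Z, [/\ continuous N, (forall w, U (N w)),
    (forall s t : R, t <= 0 -> N (s, t) = p s) &
    (forall s t : R, s <= 0 \/ 1 <= s \/ 1 <= t -> N (s, t) = x)].
Proof.
move=> [cp Up p0 p1] [N [cN UN N01 Nside]].
exists (fun w => N (clamp w.1, clamp w.2)); split.
- apply: (@continuous_within_comp _ (R * R)%type _ (fun w => (clamp w.1, clamp w.2)) _ _ _ cN).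
    apply: continuous_pair; apply: continuous_compT continuous_clamp => w.
      exact: cvg_fst.
    exact: cvg_snd.
  by move=> s; split; exact: clamp_in.
- by move=> w; apply: UN; exact: clamp_in.
- move=> s t t0 /=; rewrite (clamp_le0 t0) (N01 _ (clamp_in s)).1.
  have [s0|s0] := leP s 0; first by rewrite clamp_le0// !p0.
  have [s1|s1] := leP 1 s; first by rewrite clamp_ge1// !p1.
  by rewrite clampK// !ltW.
- move=> s t /=; have [Nl Nr] := Nside _ (clamp_in t).
  case=> [s0|[s1|t1]]; first by rewrite clamp_le0// Nl p0.
    by rewrite (clamp_ge1 s1) Nr p1.
  by rewrite (clamp_ge1 t1) (N01 _ (clamp_in s)).2 p0.
Qed.

End paths.

(** * Filling loops by bigons and squares; from free to based nullhomotopies *)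

Section fill.
Context {R : realType} {Z : topologicalType}.
Implicit Types (U D : set Z) (x y : Z) (p q f : R -> Z).

(* [t] may be discontinuous at [w]: this is how a square is mapped to a bigon,
   whose sides [H (0, _)] and [H (1, _)] are constant. *)
Lemma continuous_tube (T : topologicalType) (H : R * R -> Z) (s t : T -> R) (x : Z) (w : T) :
  continuous H -> (forall r : R, r \in `[0, 1] -> H (s w, r) = x) ->
  {for w, continuous s} -> (forall v, t v \in `[0, 1]) ->
  {for w, continuous (fun v => H (s v, t v))}.
Proof.
move=> cH Hx cs t01 B; rewrite Hx// => nB.
have : \forall r \near nbhs (s w), `[0, 1] `<=` [set r' | B (H (r, r'))].
  have /compact_near_coveringP := @segment_compact R 0 1; apply => r r01.
  have : \forall v \near (s w, r), B (H v) by apply: cH; rewrite Hx.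
  move=> [[P Q]/= [nP nQ] PQ].
  by exists (Q, P) => //= -[a b] /= [Qa Pb]; exact: (PQ (b, a)).
move=> /cs; change ((\forall v \near w, `[0, 1] `<=` [set r | B (H (s v, r))]) ->
  \forall v \near w, B (H (s v, t v))) => nw.
by apply: filterS nw => v /(_ (t v)); apply; exact: t01.
Qed.

(* The nullhomotopy [N] of [p * q^-1] equals [x] on the three other sides of the
   square and beyond them, so it is precomposed with a map that sends the side
   [s = 0] to those three sides, [t = 0] and [t = 1] to the two halves of the
   bottom side, and [s = 1] to its midpoint. *)
Lemma nullhomotopic_bigon U x y p q :
  total_path U x y p -> total_path U x y q ->
  nullhomotopic U (path_cat p (fun t => q (1 - t))) ->
  exists H : R * R -> Z, [/\ continuous H, (forall w, U (H w)),
    (forall s : R, 0 <= s <= 1 -> H (s, 0) = p s /\ H (s, 1) = q s) &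
    (forall t : R, 0 <= t <= 1 -> H (0, t) = x /\ H (1, t) = y)].
Proof.
move=> tp tq; have tL := total_path_cat tp (total_path_rev tq).
move=> /(total_nullhomotopy tL)[N [cN UN N0 Nx]].
have [_ _ p0 p1] := tp; have [_ _ q0 q1] := tq.
(* At [w.1 = 0] the point climbs the left side for [w.2 <= 1/4], crosses at height at least 1, and
   descends the right side for [w.2 >= 3/4]. The factor [1 - w.1] contracts this curve to the
   midpoint (1/2, 0) of the bottom side. *)
exists (fun w => N (2^-1 + (1 - w.1) * (clamp (2 * w.2 - 2^-1) - 2^-1),
                    4 * ((1 - w.1) * Num.min w.2 (1 - w.2)))); split => //.
- by apply: continuous_compT cN; continuity.
- move=> s /andP[s0 s1]; split => /=.
  + rewrite clamp_le0; last lra.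
    rewrite N0; last by rewrite min_l; lra.
    rewrite /path_cat ifT; last lra.
    by congr p; lra.
  + rewrite clamp_ge1; last lra.
    rewrite N0; last by rewrite min_r; lra.
    rewrite /path_cat; case: ifPn => h; first by rewrite p1 ?q1//; lra.
    by congr q; lra.
- move=> t /andP[t0 t1]; split => /=.
  + apply: Nx; have [t4|t4] := leP t (1/4).
      by left; rewrite clamp_le0; lra.
    right; have [t4'|t4'] := leP (3/4) t; first by left; rewrite clamp_ge1; lra.
    right; case: (leP t (1 - t)) => ?; lra.
  + rewrite N0; last lra.
    rewrite /path_cat ifT; last lra.
    by rewrite p1//; lra.
Qed.

(** The bigon between [l] followed by [q] and [p] followed by [r] is spread over the square along
    the antidiagonals: [sg] tells which antidiagonal a point is on, [ta] its relative position
    there. The constant sides of the bigon become the corners (0, 0) and (1, 1). *)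
Lemma square_fill U x y0 y1 y p q l r :
  total_path U x y0 l -> total_path U y0 y q ->
  total_path U x y1 p -> total_path U y1 y r ->
  nullhomotopic U (path_cat (path_cat l q) (fun t => path_cat p r (1 - t))) ->
  exists S : R * R -> Z, [/\ continuous S, (forall w, U (S w)),
    (forall s : R, 0 <= s <= 1 -> S (s, 0) = p s /\ S (s, 1) = q s) &
    (forall t : R, 0 <= t <= 1 -> S (0, t) = l t /\ S (1, t) = r t)].
Proof.
move=> tl tq tp tr; have tP := total_path_cat tl tq; have tQ := total_path_cat tp tr.
move=> /(nullhomotopic_bigon tP tQ)[H [cH UH Hpq Hxy]].
have [_ _ p0 p1] := tp; have [_ _ q0 q1] := tq.
have [_ _ l0 l1] := tl; have [_ _ r0 r1] := tr.
(* [ta] is the junk value [1/2] at the corners (0, 0) and (1, 1), where [m]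
   vanishes. *)
pose m (s t : R) := Num.min (s + t) (2 - s - t).
pose sg (w : R * R) := (clamp w.1 + clamp w.2) / 2.
pose ta (w : R * R) :=
  clamp (2^-1 + (clamp w.1 - clamp w.2) / (2 * m (clamp w.1) (clamp w.2))).
have lo (s : R) : 0 <= s <= 1 -> s / 2 - 2^-1 <= 0 by move=> /andP[? ?]; lra.
exists (fun w => H (sg w, ta w)); split => //.
- move=> w; have csg : continuous sg by rewrite /sg; continuity.
  have cm : continuous (fun w : R * R => 2 * m (clamp w.1) (clamp w.2)).
    by rewrite /m; continuity.
  have [m0|mN0] := eqVneq (2 * m (clamp w.1) (clamp w.2)) 0; last first.
    have cd : continuous (fun w : R * R => clamp w.1 - clamp w.2) by continuity.
    have ce : {for w, continuous (fun w : R * R => 2^-1 +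
        (clamp w.1 - clamp w.2) / (2 * m (clamp w.1) (clamp w.2)))}.
      apply: cvgD; first exact: cvg_cst.
      apply: cvgM; first exact: (cd w).
      by apply: cvgV => //; exact: (cm w).
    have cta : {for w, continuous ta}.
      by apply: continuous_comp ce _; exact: continuous_clamp.
    apply: (@continuous_comp _ _ _ (fun w => (sg w, ta w)) H); last exact: cH.
    exact: (cvg_pair (csg w) cta).
  have [sg0|sg1] : sg w = 0 \/ sg w = 1.
  + move: m0; rewrite /sg /m; have := clamp_itv w.1; have := clamp_itv w.2.
    by case: (leP (clamp w.1 + clamp w.2)) => *; [left|right]; lra.
  + apply: (continuous_tube cH (x := x)) => [r2 r01||v]; [|exact: csg|exact: clamp_in].
    by rewrite sg0; apply: (Hxy r2 _).1; rewrite in_itv in r01.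
  + apply: (continuous_tube cH (x := y)) => [r2 r01||v]; [|exact: csg|exact: clamp_in].
    by rewrite sg1; apply: (Hxy r2 _).2; rewrite in_itv in r01.
- move=> s s01; have /andP[s0 s1] := s01.
  rewrite /sg /ta /m /= clampK// [clamp 0]clamp_le0// [clamp 1]clamp_ge1//; split.
  + have [->|sn0] := eqVneq s 0.
      by rewrite addr0 mul0r (Hxy _ (clamp_itv _)).1 p0.
    have s_gt0 : 0 < s by rewrite lt_neqAle eq_sym sn0.
    rewrite addr0 subr0 min_l; last lra.
    rewrite clamp_ge1; last by rewrite invfM mulrCA divff//; lra.
    rewrite (Hpq _ _).2; last lra.
    by rewrite /path_cat lo//; congr p; lra.
  + have [->|sn1] := eqVneq s 1.
      by rewrite (_ : (1 + 1) / 2 = 1); [rewrite (Hxy _ (clamp_itv _)).2 q1|lra].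
    have s_lt1 : s < 1 by rewrite lt_neqAle sn1.
    rewrite min_r; last lra.
    rewrite clamp_le0; last first.
      by rewrite (_ : (s - 1) / _ = - 2^-1); [lra|field; lra].
    rewrite (Hpq _ _).1; last lra.
    rewrite /path_cat; case: ifPn => h; last by congr q; lra.
    by rewrite l1 ?q0//; lra.
- move=> s s01; have /andP[s0 s1] := s01.
  rewrite /sg /ta /m /= [clamp s]clampK// [clamp 0]clamp_le0// [clamp 1]clamp_ge1//; split.
  + have [->|sn0] := eqVneq s 0.
      by rewrite addr0 mul0r (Hxy _ (clamp_itv _)).1 l0.
    have s_gt0 : 0 < s by rewrite lt_neqAle eq_sym sn0.
    rewrite add0r min_l; last lra.
    rewrite clamp_le0; last first.
      by rewrite (_ : (0 - s) / _ = - 2^-1); [lra|field; lra].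
    rewrite (Hpq _ _).1; last lra.
    by rewrite /path_cat lo//; congr l; lra.
  + have [->|sn1] := eqVneq s 1.
      by rewrite (_ : (1 + 1) / 2 = 1); [rewrite (Hxy _ (clamp_itv _)).2 r1|lra].
    have s_lt1 : s < 1 by rewrite lt_neqAle sn1.
    rewrite min_r; last lra.
    rewrite clamp_ge1; last first.
      by rewrite (_ : (1 - s) / _ = 2^-1); [lra|field; lra].
    rewrite (Hpq _ _).2; last lra.
    rewrite /path_cat; case: ifPn => h; last by congr r; lra.
    by rewrite p1 ?r0//; lra.
Qed.

(* For [t <= 1/2] the loop is conjugated by longer and longer initial pieces of
   [K (0, _)]; when it has become [K (0, _)], a constant and the reverse of
   [K (0, _)], it retracts along itself. *)
Lemma nullhomotopic_free U a f (K : R * R -> Z) :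
  continuous K -> (forall w, U (K w)) ->
  (forall s : R, 0 <= s <= 1 -> K (s, 0) = f s /\ K (s, 1) = a) ->
  (forall t : R, 0 <= t <= 1 -> K (0, t) = K (1, t)) ->
  nullhomotopic U f.
Proof.
move=> cK UK Kf K01.
(* At stage [u] the path [K (c u s, mu u s)] climbs [K (0, _)] to height [u] for [s <= u / 3],
   crosses [K (_, u)], and comes down [K (1, _)] for [s >= 1 - u / 3]. *)
pose mu (u s : R) := Num.min u (Num.min (3 * s) (3 * (1 - s))).
pose c (u s : R) := clamp ((s - u / 3) / (1 - 2 * u / 3)).
have c0 (u : R) : 0 <= u <= 1 -> c u 0 = 0.
  by move=> u01; rewrite /c clamp_le0// pmulr_lle0 ?invr_gt0; lra.
have c1 (u : R) : 0 <= u <= 1 -> c u 1 = 1.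
  by move=> u01; rewrite /c clamp_ge1// ler_pdivlMr; lra.
have mu0 (u : R) : 0 <= u <= 1 -> mu u 0 = 0.
  by move=> u01; rewrite /mu mulr0 (min_l (y := 3 * _)) ?min_r//; lra.
have mu1 (u : R) : 0 <= u <= 1 -> mu u 1 = 0.
  by move=> u01; rewrite /mu (min_r (y := 3 * _)) ?min_r//; lra.
have K00 : K (0, 0) = f 0 by rewrite (Kf 0 _).1//; lra.
have K10 : K (1, 0) = f 1 by rewrite (Kf 1 _).1//; lra.
have f01 : f 0 = f 1 by rewrite -K00 -K10 K01//; lra.
exists (fun w => if 2 * w.2 - 1 <= 0
  then K (c (clamp (2 * w.2)) (clamp w.1), mu (clamp (2 * w.2)) (clamp w.1))
  else K (0, mu (clamp (2 - 2 * w.2)) (clamp w.1))); split.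
- apply: continuous_subspaceT; apply: continuous_glue.
  + by continuity.
  + apply: continuous_compT cK; apply: continuous_pair; last by rewrite /mu; continuity.
    apply: continuous_clamp_comp => w; apply: cvgM.
      suff : continuous (fun w : R * R => clamp w.1 - clamp (2 * w.2) / 3) by apply.
      by continuity.
    apply: cvgV; first by have := clamp_itv (2 * w.2); lra.
    suff : continuous (fun w : R * R => 1 - 2 * clamp (2 * w.2) / 3) by apply.
    by continuity.
  + by apply: continuous_compT cK; rewrite /mu; continuity.
  + move=> [s t] /= t2; have -> : 2 * t = 1 by lra.
    rewrite [2 - 1](_ : _ = 1); last lra.
    rewrite [clamp 1]clampK; last lra.
    have := clamp_itv s; move: (clamp s) => {}s s01.
    rewrite /c /mu; have [s3|s3] := leP s (1/3).
      by rewrite clamp_le0// pmulr_lle0 ?invr_gt0; lra.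
    have [s4|s4] := leP (2/3) s.
      rewrite clamp_ge1; last by rewrite ler_pdivlMr; lra.
      by rewrite min_r ?min_r ?K01//; lra.
    rewrite min_l; last by rewrite le_min; apply/andP; split; lra.
    by rewrite !(Kf _ _).2//; [lra|exact: clamp_itv].
- by move=> s t s01 t01; case: ifP.
- move=> s; rewrite in_itv /= => s01; split.
  + rewrite mulr0 sub0r lerN10 [clamp 0]clamp_le0//.
    rewrite /c /mu clampK// !(mulr0, mul0r, subr0) invr1 mulr1 clampK//.
    by rewrite min_l ?(Kf _ _).1// le_min; apply/andP; split; lra.
  + rewrite mulr1 ifF; last by apply/negbTE; rewrite -ltNge; lra.
    rewrite subrr [clamp 0]clamp_le0// clampK// /mu min_l ?K00//.
    by rewrite le_min; apply/andP; split; lra.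
- move=> t; rewrite in_itv /= => t01.
  rewrite [clamp 0]clamp_le0// [clamp 1]clamp_ge1// !mu0 ?mu1 ?clamp_itv//.
  by rewrite c0 ?c1 ?clamp_itv// K00 K10 -f01; case: ifP.
Qed.

End fill.

Lemma path_homotopic_sub (R : realType) (Y : topologicalType) (U V : set Y) (f g : R -> Y) :
  U `<=` V -> path_homotopic U f g -> path_homotopic V f g.
Proof. by move=> UV [H [? UH ? ?]]; exists H; split => // s t s1 t1; exact/UV/UH. Qed.

(** * Thickenings of a compact set, and local properties made uniform along it *)

Section metric.
Context {R : realType} {X : metricType R}.
Implicit Types (A U V W : set X) (x y : X) (d e : R).

Lemma open_metric_ball x e : open (ball x e).
Proof.
rewrite openE => y; rewrite ballEmdist /= => xy; apply/nbhs_ballP.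
exists (e - mdist x y); first by rewrite /= subr_gt0.
by move=> z; rewrite !ballEmdist /= => yz; have := metric_triangle x y z; lra.
Qed.

Lemma open_ballP U x : open U -> U x -> exists2 d, 0 < d & ball x d `<=` U.
Proof.
move=> oU Ux; have /nbhs_ballP[d d0 dU] := open_nbhs_nbhs (conj oU Ux).
by exists d.
Qed.

Definition thickening A e : set X := [set x | exists2 a, A a & mdist a x < e].

Lemma open_thickening A e : open (thickening A e).
Proof.
rewrite (_ : thickening A e = \bigcup_(a in A) ball a e).
  by apply: bigcup_open => a _; exact: open_metric_ball.
by apply/seteqP; split => x [a Aa ax]; exists a => //; move: ax; rewrite ballEmdist.
Qed.

Lemma thickeningW A d e : d <= e -> thickening A d `<=` thickening A e.
Proof. by move=> de x [a Aa ax]; exists a => //; exact: lt_le_trans de. Qed.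

Lemma subset_thickening A e : 0 < e -> A `<=` thickening A e.
Proof. by move=> e0 x Ax; exists x => //; rewrite mdistxx. Qed.

Lemma closed_notin_thickening A x : closed A -> ~ A x ->
  exists2 e, 0 < e & ~ thickening A e x.
Proof.
move=> cA nAx; have [e e0 eA] := open_ballP (closed_openC cA) nAx.
exists e => // -[a Aa ax]; apply: (eA a) => //.
by rewrite ballEmdist /= metric_sym.
Qed.

(** The Lebesgue number argument, for a property that persists when the radius shrinks: compactness
    is applied along the filter of right neighbourhoods of 0. *)
Lemma compact_uniform A (Q : R -> X -> Prop) : compact A ->
  (forall d d' x, 0 < d' <= d -> Q d x -> Q d' x) ->
  (forall x, A x -> exists2 d, 0 < d & forall y, A y -> mdist x y < d -> Q d y) ->
  exists2 d, 0 < d & forall x, A x -> Q d x.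
Proof.
move=> /compact_near_coveringP cA Qmon Qloc.
have : \forall d \near (0 : R)^'+, A `<=` [set x | A x -> Q d x].
  apply: cA => x Ax; have [d d0 Qd] := Qloc x Ax.
  exists (ball x d, [set d' | 0 < d' <= d]) => /=.
    split; first exact: nbhsx_ballx.
    by apply: filterS2 (nbhs_right_gt 0) (nbhs_right_le d0) => d' ? ?; apply/andP.
  move=> [y d'] /= [xy d'd] Ay; apply: Qmon d'd _; apply: Qd => //.
  by move: xy; rewrite ballEmdist.
move=> nA; have /filter_ex[d [d0 Qd]] :
    \forall d \near (0 : R)^'+, 0 < d /\ A `<=` [set x | A x -> Q d x].
  by apply: filterS2 (nbhs_right_gt 0) nA.
by exists d => // x Ax; exact: Qd.
Qed.

Lemma compact_thickening A W : compact A -> open W -> A `<=` W ->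
  exists2 d, 0 < d & thickening A d `<=` W.
Proof.
move=> cA oW AW.
have [|x Ax|d d0 dW] := @compact_uniform A (fun d x => ball x d `<=` W) cA.
- move=> d d' x /andP[_ d'd] dW y xy; apply: dW; exact: le_ball xy.
- have [d d0 dW] := open_ballP oW (AW x Ax).
  exists (d / 2) => [|y Ay xy z]; first lra.
  rewrite ballEmdist /= => yz; apply: dW; rewrite ballEmdist /=.
  by have := metric_triangle x y z; lra.
- by exists d => // x [a Aa ax]; apply: (dW a) => //; rewrite ballEmdist.
Qed.

Lemma uniform_path_connected A e : compact A -> locally_path_connected R X -> 0 < e ->
  exists2 d, 0 < d & forall a x y, A a -> mdist a x < d -> mdist a y < d ->
    exists f : R -> X, total_path (ball a e) x y f.
Proof.
move=> cA lX e0.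
have [|a Aa|d d0 Qd] := @compact_uniform A (fun d a => forall x y,
    mdist a x < d -> mdist a y < d -> exists f : R -> X, total_path (ball a e) x y f) cA.
- by move=> d d' a /andP[_ d'd] Qd x y ax ay; apply: Qd; exact: lt_le_trans d'd.
- have e2 : 0 < e / 2 by lra.
  have [V [oV Va Ve cV]] := lX _ _ (open_metric_ball a (e / 2)) (ballxx a e2).
  have [d d0 dV] := open_ballP oV Va.
  exists (Num.min (d / 2) (e / 2)); first by rewrite lt_min; apply/andP; split; lra.
  move=> b Ab; rewrite lt_min => /andP[abd abe] x y.
  rewrite !lt_min => /andP[xd _] /andP[yd _].
  have Vx : V x by apply: dV; rewrite ballEmdist /=; have := metric_triangle a b x; lra.
  have Vy : V y by apply: dV; rewrite ballEmdist /=; have := metric_triangle a b y; lra.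
  have [f /total_path_clamp tf] := cV _ _ Vx Vy.
  exists (f \o clamp); apply: total_path_sub tf => z /Ve; rewrite !ballEmdist /= => az.
  by have := metric_triangle b a z; rewrite (metric_sym b a); lra.
- by exists d => // a x y Aa; exact: Qd.
Qed.

Lemma uniform_simply_connected A e : compact A -> locally_simply_connected R X -> 0 < e ->
  exists2 d, 0 < d & forall a x (f : R -> X), A a -> total_path (ball a d) x x f ->
    nullhomotopic (ball a e) f.
Proof.
move=> cA lX e0.
have [|a Aa|d d0 Qd] := @compact_uniform A (fun d a => forall x (f : R -> X),
    total_path (ball a d) x x f -> nullhomotopic (ball a e) f) cA.
- move=> d d' a /andP[_ d'd] Qd x f tf; apply: (Qd x); apply: total_path_sub tf.
  exact: le_ball.
- have e2 : 0 < e / 2 by lra.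
  have [V [oV Va Ve cV]] := lX _ _ (open_metric_ball a (e / 2)) (ballxx a e2).
  have [d d0 dV] := open_ballP oV Va.
  exists (Num.min (d / 2) (e / 2)); first by rewrite lt_min; apply/andP; split; lra.
  move=> b Ab; rewrite lt_min => /andP[abd abe] x f tf.
  apply: (@path_homotopic_sub _ _ (ball a (e / 2))).
    move=> z; rewrite !ballEmdist /= => az.
    by have := metric_triangle b a z; rewrite (metric_sym b a); lra.
  apply: (cV x); apply: total_path_is_path; apply: total_path_sub tf => z.
  rewrite ballEmdist /= lt_min => /andP[bz _]; apply: dV; rewrite ballEmdist /=.
  by have := metric_triangle a b z; lra.
- by exists d => // a x f Aa; exact: Qd.
Qed.

(** Supplies the top sides of the squares: they have to run inside [A], so that the projection sends
    them to a point. *)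
Lemma uniform_path_connected_in A e : compact A -> locally_path_connected R A -> 0 < e ->
  exists2 d, 0 < d & forall a b, A a -> A b -> mdist a b < d ->
    exists f : R -> X, total_path (A `&` ball a e) a b f.
Proof.
move=> cA lA e0.
have [|a Aa|d d0 Qd] := @compact_uniform A (fun d a => forall b,
    A b -> mdist a b < d -> exists f : R -> X, total_path (A `&` ball a e) a b f) cA.
- by move=> d d' a /andP[_ d'd] Qd b Ab ab; apply: Qd => //; exact: lt_le_trans d'd.
- have e2 : 0 < e / 2 by lra.
  pose a' : A := SigSub (mem_set Aa).
  have ci : continuous (set_val : A -> X) by exact: initial_continuous.
  have oB : open ((set_val : A -> X) @^-1` ball a (e / 2)).
    have /continuousP := ci; apply; exact: open_metric_ball.
  have [V [[V' oV' VE] Va Ve cV]] := lA a' _ oB (ballxx a e2).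
  have V'a : V' a by move: Va; rewrite -VE.
  have [d d0 dV] := open_ballP oV' V'a.
  exists (Num.min (d / 2) (e / 2)); first by rewrite lt_min; apply/andP; split; lra.
  move=> b Ab; rewrite lt_min => /andP[abd abe] c Ac; rewrite lt_min => /andP[bc _].
  pose b' : A := SigSub (mem_set Ab); pose c' : A := SigSub (mem_set Ac).
  have Vb : V b' by rewrite -VE; apply: dV; rewrite ballEmdist /=; lra.
  have Vc : V c'.
    rewrite -VE; apply: dV; rewrite ballEmdist /=.
    by have := metric_triangle a b c; lra.
  have [f /total_path_clamp [cf Vf f0 f1]] := cV _ _ Vb Vc.
  exists (fun t => set_val ((f \o clamp) t)); split.
  + by apply: continuous_compT cf ci.
  + move=> t; split; first exact: set_valP.
    have := Ve _ (Vf t); rewrite /= !ballEmdist /= => h.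
    have := metric_triangle b a (set_val ((f \o clamp) t)).
    by rewrite (metric_sym b a) /=; lra.
  + by move=> t t0; rewrite f0.
  + by move=> t t0; rewrite f1.
- by exists d => // a b Aa; exact: Qd.
Qed.

(* One choice of [u] serves all [e]: it is nearly optimal, up to an error
   controlled by the distance from [pt t] to [A]. *)
Lemma uniform_choice (T U : Type) (u0 : U) (pt : T -> X) A (D : set T)
    (P : T -> U -> R -> Prop) :
  closed A -> (forall t, D t -> ~ A (pt t)) ->
  (forall t u e e', e <= e' -> P t u e -> P t u e') ->
  (forall e, 0 < e -> exists2 d, 0 < d &
    forall t, D t -> thickening A d (pt t) -> exists u, P t u e) ->
  exists h : T -> U, forall e, 0 < e -> exists2 d, 0 < d &
    forall t, D t -> thickening A d (pt t) -> P t (h t) e.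
Proof.
move=> cA DA Pmon Pex.
have /choice[h hP] : forall t, exists u, D t -> exists m,
    [/\ 0 < m, ~ thickening A m (pt t) &
      forall e, m <= e -> (exists u', P t u' e) -> P t u (2 * e)].
  move=> t; have [Dt|] := pselect (D t); last by exists u0.
  have [m m0 mA] := closed_notin_thickening cA (DA t Dt).
  (* Truncation at [m] bounds [S] below. The chosen [u] achieves some bound less than [inf S + m],
     which is at most [2 * e] for every achievable [e >= m]. *)
  pose S := [set e | m <= e /\ exists u', P t u' e].
  have [[e1 Se1]|nS] := pselect (S !=set0); last first.
    exists u0 => _; exists m; split => // e me Pe; exfalso; apply: nS; by exists e.
  have lS : lbound S m by move=> e [].
  have hS : has_inf S by split; [exists e1|exists m].
  have [e2 [_ [u Pu]] e2S] := inf_adherent m0 hS.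
  exists u => _; exists m; split => // e me Pe; apply: Pmon Pu.
  have : inf S <= e by apply: ge_inf; [exists m|split].
  lra.
exists h => e e0; have e2 : 0 < e / 2 by lra.
have [d d0 Pd] := Pex _ e2; exists (Num.min d (e / 2)).
  by rewrite lt_min; apply/andP.
move=> t Dt tA; have [m [m0 mA hm]] := hP t Dt.
rewrite (_ : e = 2 * (e / 2)); last lra.
apply: hm.
  (* [m] is a lower bound for the distance from [pt t] to [A], so being within [e / 2] of [A] forces
     [m <= e / 2]. *)
  rewrite leNgt; apply/negP => em; apply: mA; apply: thickeningW tA.
  by rewrite ge_min (ltW em) orbT.
by apply: Pd => //; apply: thickeningW tA; rewrite ge_min lexx.
Qed.

End metric.

(** * Small paths near [A], and the squares that push them into [A] *)

Section cells.
Context {R : realType} {X : metricType R}.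
Implicit Types (A : set X) (x y : X) (p : R -> X) (d e : R).

Definition path_to A x (g : R -> X) e := A (g 1) /\ total_path (ball x e) x (g 1) g.

(* The diameter is less than the distance to [A]; hence a small path starting
   close to [A] has a small diameter. *)
Definition small_path A p :=
  total_path setT (p 0) (p 1) p /\
  exists e, forall s t, mdist (p s) (p t) < e /\ ~ thickening A e (p s).

(* A homotopy from [p] into [A] along which the endpoints of [p] follow the
   paths chosen by [g], so that cells over adjacent intervals fit together. *)
Definition cell A (g : X -> R -> X) p (S : R * R -> X) e :=
  [/\ continuous S, (forall w, ball (p 0) e (S w)),
      (forall s : R, 0 <= s <= 1 -> S (s, 0) = p s /\ A (S (s, 1))) &
      (forall t : R, 0 <= t <= 1 -> S (0, t) = g (p 0) t /\ S (1, t) = g (p 1) t)].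

(** These are the paths [c_x]. A single path per point has to be small at every scale, hence
    [uniform_choice]. *)
Lemma path_to_choice A : compact A -> locally_path_connected R X ->
  exists g : X -> R -> X, forall e, 0 < e -> exists2 d, 0 < d &
    forall x, ~ A x -> thickening A d x -> path_to A x (g x) e.
Proof.
move=> cA lX.
have clA := compact_closed (@metric_hausdorff R X) cA.
have [x0|] := pselect (exists x : X, True); last first.
  by move=> nX; exists (fun x _ => x) => e e0; exists e => // x; case: nX; exists x.
case: x0 => x0 _.
apply: (@uniform_choice _ _ X _ (cst x0) id A (~` A) (path_to A)) => //.
- move=> x g e e' ee' [Ag tg]; split => //; apply: total_path_sub tg; exact: le_ball.
- move=> e e0; have e2 : 0 < e / 2 by lra.
  have [d d0 dP] := uniform_path_connected cA lX e2.
  exists (Num.min d (e / 2)); first by rewrite lt_min; apply/andP.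
  move=> x nAx [a Aa]; rewrite lt_min => /andP[axd axe].
  have [|f tf] := dP a x a Aa axd; first by rewrite mdistxx.
  have f1 : f 1 = a by case: tf => _ _ _; exact.
  exists f; split; rewrite f1//.
  apply: total_path_sub tf => z; rewrite !ballEmdist /= => az.
  by have := metric_triangle x a z; rewrite (metric_sym x a); lra.
Qed.

(** Near a point [a] of [A], the path [p], the two paths given by [g] and a short path in [A] form a
    loop in a small ball around [a]. It is nullhomotopic in a slightly larger ball, and
    [square_fill] applies. *)
Lemma cell_choice A (g : X -> R -> X) :
  compact A -> locally_1_connected R X -> locally_path_connected R A ->
  (forall e, 0 < e -> exists2 d, 0 < d &
    forall x, ~ A x -> thickening A d x -> path_to A x (g x) e) ->
  exists S : (R -> X) -> R * R -> X, forall e, 0 < e -> exists2 d, 0 < d &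
    forall p, small_path A p -> thickening A d (p 0) -> cell A g p (S p) e.
Proof.
move=> cA [lX sX] lA gP.
have clA := compact_closed (@metric_hausdorff R X) cA.
have [x0|] := pselect (exists x : X, True); last first.
  by move=> nX; exists (fun p _ => p 0) => e e0; exists e => // p; case: nX; exists (p 0).
case: x0 => x0 _.
apply: (@uniform_choice _ _ (R -> X) _ (cst x0) (fun p => p 0) A (small_path A)
  (cell A g)) => //.
- move=> p [_ [e pe]] Ap; have [pp] := pe 0 0; apply.
  apply: subset_thickening Ap; apply: le_lt_trans pp; exact: mdist_ge0.
- move=> p S e e' ee' [cS Se Sp Sg]; split => // w; exact: le_ball (Se w).
- move=> e e0; have e2 : 0 < e / 2 by lra.
  have [d2' d20' nullP'] := uniform_simply_connected cA sX e2.
  pose d2 := Num.min d2' (e / 2).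
  have d20 : 0 < d2 by rewrite lt_min; apply/andP.
  have d2e (a : X) : ball a d2 `<=` ball a (e / 2).
    by apply: le_ball; rewrite ge_min lexx orbT.
  have nullP a x (f : R -> X) : A a -> total_path (ball a d2) x x f ->
      nullhomotopic (ball a (e / 2)) f.
    move=> Aa tf; apply: (nullP' a x) => //; apply: total_path_sub tf.
    by apply: le_ball; rewrite ge_min lexx.
  clearbody d2.
  have d23 : 0 < d2 / 3 by lra.
  have [d3 d30 pathP] := uniform_path_connected_in cA lA d23.
  (* If [p 0] is within [m] of [a], then [p] stays within [2 * m], and the paths from [p 0] and
     [p 1] end within [2 * m] and [3 * m]. These ends are thus less than [d3] apart, and the path in
     [A] joining them stays within [d2 / 3 + 2 * m <= d2] of [a]. *)
  pose m := Num.min d2 (Num.min d3 e) / 6.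
  have m0 : 0 < m.
    by rewrite divr_gt0// !lt_min; apply/andP; split => //; apply/andP.
  have [m2 [m3 me]] : 6 * m <= d2 /\ (6 * m <= d3 /\ 6 * m <= e).
    have -> : 6 * m = Num.min d2 (Num.min d3 e) by rewrite /m; lra.
    by rewrite !ge_min !lexx !orbT.
  have [d1 d10 gm] := gP m m0.
  (* Half of [d1], because [p 1] is less than twice as far from [a] as [p 0] is. *)
  exists (Num.min m (d1 / 2)); first by rewrite lt_min; apply/andP; split; lra.
  move=> p [tp [r pr]] [a Aa]; rewrite lt_min => /andP[ap0m ap0d].
  have nA s : ~ A (p s).
    move=> Ap; have [pp] := pr s s; apply.
    by apply: subset_thickening Ap; apply: le_lt_trans pp; exact: mdist_ge0.
  have rle : r <= mdist a (p 0).
    by rewrite leNgt; apply/negP => h; apply: (pr 0 0).2; exists a.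
  have pm s : mdist (p 0) (p s) < mdist a (p 0) by apply: lt_le_trans rle; exact: (pr 0 s).1.
  have [|Al tl] := gm (p 0) (nA 0); first by exists a => //; lra.
  have [|Ar tr] := gm (p 1) (nA 1).
    by exists a => //; have := metric_triangle a (p 0) (p 1); have := pm 1; lra.
  set l := g (p 0) in Al tl; set q := g (p 1) in Ar tr.
  have ball_a x d d' z : mdist a x < d -> d + d' <= d2 -> ball x d' z -> ball a d2 z.
    by rewrite !ballEmdist /= => ax dd xz; have := metric_triangle a x z; lra.
  have ap1 : mdist a (p 1) < 2 * m by have := metric_triangle a (p 0) (p 1); have := pm 1; lra.
  have al1 : mdist a (l 1) < 2 * m.
    have := metric_triangle a (p 0) (l 1); case: tl => _ /(_ 1) + _ _.
    by rewrite ballEmdist /=; lra.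
  have aq1 : mdist a (q 1) < 3 * m.
    have := metric_triangle a (p 1) (q 1); case: tr => _ /(_ 1) + _ _.
    by rewrite ballEmdist /=; lra.
  have [|k tk] := pathP (l 1) (q 1) Al Ar.
    by have := metric_triangle (l 1) a (q 1); rewrite (metric_sym (l 1) a); lra.
  have tl' : total_path (ball a d2) (p 0) (l 1) l.
    by apply: total_path_sub tl => z; apply: ball_a ap0m _; lra.
  have tr' : total_path (ball a d2) (p 1) (q 1) q.
    by apply: total_path_sub tr => z; apply: ball_a ap1 _; lra.
  have tk' : total_path (ball a d2) (l 1) (q 1) k.
    by apply: total_path_sub tk => z [_]; apply: ball_a al1 _; lra.
  have tp' : total_path (ball a d2) (p 0) (p 1) p.
    case: tp => cp _ p0 p1; split => // s.
    by rewrite ballEmdist /=; have := metric_triangle a (p 0) (p s); have := pm s; lra.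
  have tL := total_path_cat (total_path_cat tl' tk') (total_path_rev (total_path_cat tp' tr')).
  have nL := nullP a _ _ Aa tL.
  have [S [cS US Spq Slr]] := square_fill (total_path_sub (d2e a) tl')
    (total_path_sub (d2e a) tk') (total_path_sub (d2e a) tp') (total_path_sub (d2e a) tr') nL.
  exists S; split => //.
    move=> w; have := US w; rewrite !ballEmdist /= => aS.
    by have := metric_triangle (p 0) a (S w); rewrite (metric_sym (p 0) a); lra.
  move=> s s01; have [-> ->] := Spq s s01; split => //.
  by case: tk => _ /(_ s)[].
Qed.


End cells.

(** * Decomposition of a set of reals into maximal dyadic intervals *)

Section dyadic.
Context {R : realType}.
Implicit Types (s t : R) (k : nat).

Definition dyadic_floor k s : int := Num.floor (2 ^+ k * s).
Definition dyadic_lo k s : R := (dyadic_floor k s)%:~R / 2 ^+ k.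
Definition dyadic_hi k s : R := (dyadic_floor k s + 1)%:~R / 2 ^+ k.

Lemma exp2_gt0 k : 0 < 2 ^+ k :> R. Proof. by rewrite exprn_gt0. Qed.

Lemma dyadic_itv k s : dyadic_lo k s <= s < dyadic_hi k s.
Proof.
have /andP[fl fu] := floor_itv (2 ^+ k * s).
by rewrite ler_pdivrMr ?exp2_gt0// ltr_pdivlMr ?exp2_gt0// mulrC fl fu.
Qed.

Lemma dyadic_hiE k s : dyadic_hi k s = dyadic_lo k s + 2 ^- k.
Proof. by rewrite /dyadic_hi intrD mulrDl mul1r. Qed.

Lemma dyadic_floor_eq k s t : dyadic_lo k s <= t < dyadic_hi k s ->
  dyadic_floor k t = dyadic_floor k s.
Proof.
by rewrite ler_pdivrMr ?exp2_gt0// ltr_pdivlMr ?exp2_gt0// mulrC => /floor_def.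
Qed.

Lemma dyadic_floorS k s :
  2 * dyadic_floor k s <= dyadic_floor k.+1 s <= 2 * dyadic_floor k s + 1.
Proof.
have /andP[fl fu] := floor_itv (2 ^+ k * s); apply/andP; split.
  by rewrite /dyadic_floor floor_ge_int exprS -mulrA intrM ler_pM2l.
rewrite -ltzD1 /dyadic_floor floor_lt_int exprS -mulrA.
rewrite -addrA (_ : 1 + 1 = 2 * 1)// -mulrDr intrM.
by rewrite ltr_pM2l.
Qed.

(** Each floor is half of the next one, rounded down, so a fine dyadic interval determines the
    coarser ones around it. *)
Lemma dyadic_floor_le j k s t : (j <= k)%N ->
  dyadic_floor k s = dyadic_floor k t -> dyadic_floor j s = dyadic_floor j t.
Proof.
move=> /subnKC <-; elim: (k - j)%N => [|n IHn]; first by rewrite addn0.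
rewrite addnS => e; apply: IHn; have := dyadic_floorS (j + n) s.
by have := dyadic_floorS (j + n) t; rewrite e; lia.
Qed.

Lemma exp2_divSK k (x : R) : x / 2 ^+ k * 2 ^+ k.+1 = 2 * x.
Proof. by rewrite exprS mulrCA divfK ?gt_eqF ?exp2_gt0. Qed.

Lemma dyadic_hi_le j k s : (j <= k)%N -> dyadic_hi k s <= dyadic_hi j s.
Proof.
move=> /subnKC <-; elim: (k - j)%N => [|n IHn]; first by rewrite addn0.
rewrite addnS; apply: le_trans IHn.
rewrite /dyadic_hi ler_pdivrMr ?exp2_gt0// exp2_divSK.
rewrite -(intrM _ 2) ler_int.
by have /andP[_] := dyadic_floorS (j + n) s; lia.
Qed.

Lemma dyadic_lo_le j k s : (j <= k)%N -> dyadic_lo j s <= dyadic_lo k s.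
Proof.
move=> /subnKC <-; elim: (k - j)%N => [|n IHn]; first by rewrite addn0.
rewrite addnS; apply: (le_trans IHn).
rewrite /dyadic_lo ler_pdivlMr ?exp2_gt0// exp2_divSK.
rewrite -(intrM _ 2) ler_int.
by have /andP[+ _] := dyadic_floorS (j + n) s; lia.
Qed.

Lemma dyadic_lo_int k (n : int) : dyadic_lo k n%:~R = n%:~R.
Proof.
rewrite /dyadic_lo /dyadic_floor.
have -> : 2 ^+ k * n%:~R = (2 ^+ k * n)%:~R :> R by rewrite intrM rmorphXn.
by rewrite intrKfloor intrM rmorphXn /= mulrC mulKf// gt_eqF ?exp2_gt0.
Qed.

Lemma dyadic_small (e : R) : 0 < e -> exists k, 2 ^- k < e :> R.
Proof.
move=> e0; exists (Num.bound e^-1); rewrite invf_plt ?posrE ?exp2_gt0//.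
exact: upper_nthrootP.
Qed.

(** A Whitney-type decomposition, [G u v] meaning that [u, v] is admissible: each point takes the
    coarsest admissible half-open dyadic interval around it. The third clause prevents intervals
    from accumulating at [s] from the left; on the right this is clear from [s < hi s]. The last
    clause serves at the parameters 0 and 1. *)
Lemma maximal_dyadic_partition (G : R -> R -> Prop) (O : set R) :
  (forall u v u' v', u <= u' -> v' <= v -> G u v -> G u' v') ->
  (forall s, O s -> exists2 e, 0 < e & G (s - e) (s + e)) ->
  (forall u v s, G u v -> u <= s <= v -> O s) ->
  exists lo hi : R -> R,
    [/\ forall s, O s -> lo s <= s < hi s /\ G (lo s) (hi s),
        forall s t, O s -> lo s <= t < hi s -> lo t = lo s /\ hi t = hi s,
        forall s, O s -> exists t, [/\ O t, t < s & s <= hi t] &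
        forall n : int, O n%:~R -> lo n%:~R = n%:~R].
Proof.
move=> Gsub Gex GO.
pose good s k := `[< G (dyadic_lo k s) (dyadic_hi k s) >].
have good_ex s : O s -> exists k, good s k.
  move=> /Gex[e e0 Ge]; have [k ke] := dyadic_small e0; exists k; apply/asboolP.
  have := dyadic_itv k s; rewrite dyadic_hiE => /andP[? ?].
  by apply: Gsub Ge; lra.
pose K s := if pselect (O s) is left Os then ex_minn (good_ex s Os) else 0%N.
have KG s : O s -> good s (K s) /\ forall k, good s k -> (K s <= k)%N.
  by move=> Os; rewrite /K; case: pselect => // ?; case: ex_minnP.
have GOs s k : good s k -> O s.
  by move=> /asboolP/GO; apply; have /andP[-> /ltW] := dyadic_itv k s.
(* The interval of [s] is admissible for [t], so [K t <= K s]. By nesting, [s] and [t] then share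
   their interval of level [K t], so minimality for [s] gives equality. *)
have Keq s t : O s -> dyadic_lo (K s) s <= t < dyadic_hi (K s) s ->
    K t = K s /\ dyadic_floor (K t) t = dyadic_floor (K s) s.
  move=> Os /dyadic_floor_eq ts; have [gs Kmin] := KG s Os.
  have gt : good t (K s) by move: gs; rewrite /good /dyadic_lo /dyadic_hi ts.
  have [gt' Kmin'] := KG t (GOs _ _ gt).
  have Kts := Kmin' _ gt; have tsK := dyadic_floor_le Kts ts.
  have KE : K t = K s.
    apply/eqP; rewrite eqn_leq Kts Kmin//; move: gt'.
    by rewrite /good /dyadic_lo /dyadic_hi tsK.
  by split => //; rewrite KE.
exists (fun s => dyadic_lo (K s) s), (fun s => dyadic_hi (K s) s); split.
- by move=> s Os; split; [exact: dyadic_itv|apply/asboolP; exact: (KG s Os).1].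
- by move=> s t Os /(Keq _ _ Os)[KE fE]; rewrite /dyadic_lo /dyadic_hi fE KE.
(* If [s] is the left end of its interval, take [t = s - 2 ^- m] with [m] large: as [m >= K s], the
   interval of level [m] at [t] is [t, s), and the maximal one reaches at least as far. Otherwise
   the left end of the interval of [s] will do. *)
- move=> s Os; have := dyadic_itv (K s) s; rewrite le_eqVlt => /andP[/orP[/eqP sE _|ls sh]].
    have [e e0 Ge] := Gex s Os; have [k ke] := dyadic_small e0.
    pose m := maxn k (K s).
    have mE : 2 ^- m <= 2 ^- k :> R.
      by rewrite lef_pV2 ?posrE ?exp2_gt0// ler_eXn2l ?leq_maxl// ltr1n.
    have sE' : s = dyadic_lo m s.
      apply/eqP; rewrite eq_le (andP (dyadic_itv m s)).1 andbT -{1}sE.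
      by rewrite dyadic_lo_le// leq_maxr.
    have sF : 2 ^+ m * s = (dyadic_floor m s)%:~R.
      by rewrite [in LHS]sE' /dyadic_lo mulrC divfK ?gt_eqF ?exp2_gt0.
    pose t := s - 2 ^- m.
    have ft : dyadic_floor m t = dyadic_floor m s - 1.
      apply: floor_def; rewrite subrK /t mulrBr divff ?gt_eqF ?exp2_gt0//.
      by rewrite sF intrB lexx /= gtrBl.
    have hit : dyadic_hi m t = s by rewrite [RHS]sE' /dyadic_hi ft subrK.
    have lot : dyadic_lo m t = t by apply: (addIr (2 ^- m)); rewrite -dyadic_hiE hit subrK.
    have ts : t < s by rewrite gtrBl invr_gt0 exp2_gt0.
    have gt : good t m.
      by apply/asboolP; apply: Gsub Ge; rewrite ?lot ?hit /t; lra.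
    have Ot := GOs _ _ gt; exists t; split => //.
    by rewrite -{1}hit dyadic_hi_le//; have [_] := KG t Ot; apply.
  exists (dyadic_lo (K s) s).
  have lsi : dyadic_lo (K s) s <= dyadic_lo (K s) s < dyadic_hi (K s) s.
    by rewrite lexx (lt_trans ls).
  have [KE fE] := Keq _ _ Os lsi; split => //.
    by have [/asboolP gs _] := KG s Os; apply: GO gs _; rewrite lexx ltW// (lt_trans ls).
  by rewrite [leRHS]/dyadic_hi fE KE ltW.
- by move=> n _; exact: dyadic_lo_int.
Qed.

End dyadic.

(** * The free contraction of a loop near the collapsed set *)

Section contraction.
Context {R : realType} {X : metricType R} {Y : topologicalType}.
Context (A : set X) (pi : X -> Y) (y0 : Y) (U : set Y).
Context (cA : compact A) (lX : locally_1_connected R X)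
  (lA : locally_path_connected R A) (cpi : continuous pi)
  (piA : forall a, A a -> pi a = y0) (oU : open U) (Uy0 : U y0).

Lemma preimage_thickening B : open B -> B y0 ->
  exists2 e, 0 < e & thickening A e `<=` pi @^-1` B.
Proof.
move=> oB By0; apply: compact_thickening => //; first exact: open_comp.
by move=> a Aa; rewrite /= piA.
Qed.

Section fixed_path.
Context (g : R -> X) (c : X -> R -> X) (S : (R -> X) -> R * R -> X) (e0 d0 : R).
(** [g] stands for a lift of a loop by chosen representatives. Such a lift may jump where the loop
    meets the collapsed point; there it is only known to approach [A]. *)
Context (cg : forall s, ~ A (g s) -> {for s, continuous g})
  (gA : forall s e, A (g s) -> 0 < e -> \forall t \near s, thickening A e (g t))
  (g01 : g 0 = g 1)
  (e0U : thickening A e0 `<=` pi @^-1` U)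
  (d0e0 : d0 <= e0 / 2)
  (d0g : forall s, thickening A d0 (g s))
  (d0S : forall p, small_path A p -> thickening A d0 (p 0) -> cell A c p (S p) (e0 / 2))
  (SA : forall e, 0 < e -> exists2 d, 0 < d &
    forall p, small_path A p -> thickening A d (p 0) -> cell A c p (S p) e).

Let small u v := exists e, forall s t, u <= s <= v -> u <= t <= v ->
  mdist (g s) (g t) < e /\ ~ thickening A e (g s).

Let small_sub u v u' v' : u <= u' -> v' <= v -> small u v -> small u' v'.
Proof.
by move=> uu vv [e se]; exists e => s t /andP[? ?] /andP[? ?]; apply: se; lra.
Qed.

Let small_avoid u v s : small u v -> u <= s <= v -> ~ A (g s).
Proof.
move=> [e se] suv As; have [ss] := se s s suv suv; apply.
by apply: subset_thickening As; apply: le_lt_trans ss; exact: mdist_ge0.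
Qed.

Let small_ex s : ~ A (g s) -> exists2 e, 0 < e & small (s - e) (s + e).
Proof.
move=> nA; have clA := compact_closed (@metric_hausdorff R X) cA.
have [r r0 nr] := closed_notin_thickening clA nA.
have r4 : 0 < r / 4 by lra.
have /nbhs_ballP[e /= e_gt0 ge] := cg nA (nbhsx_ballx (g s) _ r4).
(* Moving by less than [r / 4] keeps the diameter below [r / 2] and the distance to [A] above it. *)
exists (e / 2); first lra; exists (r / 2).
have gs t : s - e / 2 <= t <= s + e / 2 -> mdist (g s) (g t) < r / 4.
  move=> te; have : ball (g s) (r / 4) (g t).
    by apply: ge; rewrite -ball_normE /= ltr_norml; lra.
  by rewrite ballEmdist.
move=> t u /gs gt /gs gu; split.
  by have := metric_triangle (g t) (g s) (g u); rewrite (metric_sym (g t) (g s)); lra.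
move=> [a Aa at2]; apply: nr; exists a => //.
by have := metric_triangle a (g t) (g s); rewrite (metric_sym (g t) (g s)); lra.
Qed.

Lemma free_contraction_path : exists K : R * R -> Y,
  [/\ continuous K, (forall w, U (K w)),
      (forall s : R, 0 <= s <= 1 -> K (s, 0) = pi (g s) /\ K (s, 1) = y0) &
      (forall t : R, 0 <= t <= 1 -> K (0, t) = K (1, t))].
Proof.
have [lo [hi [lohi lohiE left_nbhd lo_int]]] :=
  maximal_dyadic_partition small_sub small_ex small_avoid.
(* Both [p s] and [cl s] depend on [s] only through its interval, so all points of an interval get
   the same square. Each [cl s] is defined on the whole plane, which allows gluing neighbours. *)
pose p s t := g (lo s + (hi s - lo s) * clamp t).
pose cl s (w : R * R) := S (p s) ((w.1 - lo s) / (hi s - lo s), clamp w.2).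
have lt_lohi s : ~ A (g s) -> lo s < hi s.
  by move=> /lohi[/andP[ls sh] _]; exact: le_lt_trans sh.
have p_itv s t : ~ A (g s) -> lo s <= lo s + (hi s - lo s) * clamp t <= hi s.
  move=> /lt_lohi lh; have /andP[t0 t1] := clamp_itv t.
  rewrite lerDl mulr_ge0 ?subr_ge0 ?(ltW lh)//=.
  by rewrite -lerBrDl ler_piMr// subr_ge0 ltW.
have p0 s : p s 0 = g (lo s) by rewrite /p clamp_le0// mulr0 addr0.
have p1 s : p s 1 = g (hi s) by rewrite /p clamp_ge1// mulr1 subrKC.
have small_p s : ~ A (g s) -> small_path A (p s).
  move=> nAs; have [lsh sm] := lohi s nAs; split; last first.
    by have [e se] := sm; exists e => t u; apply: se; exact: p_itv.
  split => //.
  + move=> t; apply: (@continuous_comp _ _ _ (fun t => lo s + (hi s - lo s) * clamp t) g).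
      suff : continuous (fun t => lo s + (hi s - lo s) * clamp t) by apply.
      by continuity.
    by apply: cg; apply: small_avoid sm _; exact: p_itv.
  + by move=> t t0; rewrite /p !clamp_le0.
  + by move=> t t1; rewrite /p !clamp_ge1.
have cellS s : ~ A (g s) -> cell A c (p s) (S (p s)) (e0 / 2).
  by move=> nAs; apply: d0S; [exact: small_p|rewrite p0].
have ccl s : ~ A (g s) -> continuous (cl s).
  move=> /cellS[cS _ _ _]; apply: continuous_compT cS; continuity.
have cl_lo s t : ~ A (g s) -> cl s (lo s, t) = c (g (lo s)) (clamp t).
  move=> nAs; have [_ _ _ Sc] := cellS s nAs.
  by rewrite /cl subrr mul0r (Sc _ (clamp_itv t)).1 p0.
have cl_hi s t : ~ A (g s) -> cl s (hi s, t) = c (g (hi s)) (clamp t).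
  move=> nAs; have [_ _ _ Sc] := cellS s nAs.
  by rewrite /cl divff ?subr_eq0 ?gt_eqF ?lt_lohi// (Sc _ (clamp_itv t)).2 p1.
have cl_eq s t : ~ A (g s) -> lo s <= t < hi s -> cl t = cl s.
  by move=> nAs tlh; rewrite /cl /p; have [-> ->] := lohiE s t nAs tlh.
pose K (w : R * R) := if pselect (A (g w.1)) then y0 else pi (cl w.1 w).
exists K.
have KA s t : A (g s) -> K (s, t) = y0 by rewrite /K; case: pselect.
have KN s t : ~ A (g s) -> K (s, t) = pi (cl s (s, t)) by rewrite /K; case: pselect.
have near1 (P : R -> Prop) (s t : R) :
    (\forall r \near s, P r) -> \forall v \near (s, t), P v.1.
  by move=> nP; exists ([set r | P r], setT) => /=; [split => //; exact: filterT|move=> v []].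
have cKA s t : A (g s) -> {for (s, t), continuous K}.
  move=> As B; rewrite KA// nbhsE => -[B' [oB' B'y0] B'B].
  have [e1 e10 e1B] := preimage_thickening oB' B'y0.
  have e12 : 0 < e1 / 2 by lra.
  have [d d_gt0 dS] := SA e12.
  (* Since [g s'] is within [m] of [A], smallness over its interval puts [g (lo s')] within [2 * m]
     of [A]. This is less than [d], and the cell of radius [e1 / 2] around it stays in the
     [e1]-thickening. *)
  have m0 : 0 < Num.min d e1 / 4 by rewrite divr_gt0// lt_min; apply/andP.
  have md : 4 * (Num.min d e1 / 4) <= d by rewrite mulrC divfK// ge_min lexx.
  have me : 4 * (Num.min d e1 / 4) <= e1 by rewrite mulrC divfK// ge_min lexx orbT.
  move: (Num.min d e1 / 4) m0 md me => m m0 md me.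
  apply: filterS (near1 _ _ t (gA As m0)) => -[s' t'] /= [a Aa am]; apply: B'B.
  have [As'|nAs'] := pselect (A (g s')); first by rewrite KA.
  rewrite KN//; apply: e1B.
  have [/andP[ls sh] [r sr]] := lohi s' nAs'.
  have [||gr nr] := sr s' (lo s').
  - by rewrite ls ltW.
  - by rewrite lexx ltW// lt_lohi.
  have rm : r <= m.
    by rewrite leNgt; apply/negP => mr; apply: nr; exists a => //; exact: lt_trans mr.
  have alo : mdist a (g (lo s')) < 2 * m.
    by have := metric_triangle a (g s') (g (lo s')); lra.
  have [|_ /(_ ((s' - lo s') / (hi s' - lo s'), clamp t')) + _ _] := dS _ (small_p _ nAs').
    by rewrite p0; exists a => //; lra.
  rewrite p0 ballEmdist /= /cl /=; set z := S _ _ => gS; exists a => //.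
  by have := metric_triangle a (g (lo s')) z; lra.
(* Near [s], only the cell of some [w < s] whose interval reaches [s] matters on the left, and the
   cell of [s] on the right. *)
have cKN s t : ~ A (g s) -> {for (s, t), continuous K}.
  move=> nAs; have [w [nAw ws shw]] := left_nbhd s nAs.
  have [/andP[lw wh] small_w] := lohi w nAw; have [/andP[ls sh] small_s] := lohi s nAs.
  have cl_ws r : cl w (s, r) = cl s (s, r).
    have [hs|sh'] := ltP s (hi w).
      by rewrite (cl_eq w s nAw)// hs andbT; lra.
    (* Now [s] must be the left end of its own interval, since otherwise the two intervals would
       overlap at [z]. Both cells then follow [c (g s)] over [s]. *)
    have {shw sh'}hw : hi w = s by apply/eqP; rewrite eq_le sh' shw.
    have los : lo s = s.
      apply/eqP; rewrite eq_le ls leNgt; apply/negP => ls'.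
      pose z := Num.max w (lo s).
      have zs : z < s by rewrite gt_max ws ls'.
      have [_ hz] : lo z = lo w /\ hi z = hi w.
        by apply: lohiE => //; rewrite hw zs andbT le_max lw.
      have [_ hz'] : lo z = lo s /\ hi z = hi s.
        by apply: lohiE => //; rewrite (lt_trans zs sh) andbT le_max lexx orbT.
      by move: sh; rewrite -hz' hz hw ltxx.
    by rewrite -{1}hw cl_hi// hw -[in RHS]los; have := cl_lo s r nAs; rewrite los => ->.
  have eqK : \forall v \near (s, t),
      K v = if v.1 - s <= 0 then pi (cl w v) else pi (cl s v).
    have : \forall r \near s, w < r < hi s.
      by apply: filterS2 (lt_nbhsr ws) (lt_nbhsl sh) => r wr rs; apply/andP.
    move=> /(near1 _ _ t); apply: filterS => -[r u] /= /andP[wr rs].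
    have [rs'|rs'] := leP (r - s) 0.
      have nAr : ~ A (g r) by apply: small_avoid small_w _; lra.
      rewrite KN//; congr pi; have [rs0|rs0] := eqVneq r s; first by rewrite rs0 cl_ws.
      have r_lt_s : r < s by rewrite lt_neqAle rs0; lra.
      by rewrite (cl_eq w r nAw)//; lra.
    have nAr : ~ A (g r) by apply: small_avoid small_s _; lra.
    by rewrite KN//; congr pi; rewrite (cl_eq s r nAs)//; lra.
  have cglue : {for (s, t), continuous (fun v : R * R =>
      if v.1 - s <= 0 then pi (cl w v) else pi (cl s v))}.
    apply: continuous_at_glue => /=.
    - by apply: cvgB; [exact: cvg_fst|exact: cvg_cst].
    - by apply: (continuous_compT (ccl w nAw) cpi).
    - by apply: (continuous_compT (ccl s nAs) cpi).
    - by rewrite cl_ws.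
  move=> B; rewrite (nbhs_singleton eqK) => /cglue nB.
  by apply: filterS2 eqK nB => v /= ->.
split.
- move=> [s t]; have [As|nAs] := pselect (A (g s)); last exact: cKN.
  exact: cKA.
- move=> [s t]; have [As|nAs] := pselect (A (g s)); first by rewrite KA.
  rewrite KN//; apply: e0U.
  have [_ /(_ ((s - lo s) / (hi s - lo s), clamp t)) + _ _] := cellS s nAs.
  rewrite p0 ballEmdist /= => gS; have [a Aa ag] := d0g (lo s); exists a => //.
  move: gS; rewrite /cl /=; set z := S _ _ => gS.
  by have := d0e0; have := metric_triangle a (g (lo s)) z; lra.
- move=> s s01; have [As|nAs] := pselect (A (g s)); first by rewrite !KA// piA.
  have [_ _ Sp _] := cellS s nAs.
  rewrite !KN// /cl /= [clamp 0]clamp_le0// [clamp 1]clamp_ge1//.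
  have [/andP[ls sh] _] := lohi s nAs; have lh := lt_lohi s nAs.
  have q01 : 0 <= (s - lo s) / (hi s - lo s) <= 1.
    by rewrite divr_ge0 ?subr_ge0 ?(ltW lh)//= ler_pdivrMr ?subr_gt0// mul1r lerD2r ltW.
  have [-> /piA ->] := Sp _ q01; split => //.
  by rewrite /p clampK// mulrC divfK ?subr_eq0 ?gt_eqF// subrKC.
- move=> t t01; have [A0|nA0] := pselect (A (g 0)); first by rewrite !KA// -g01.
  have nA1 : ~ A (g 1) by rewrite -g01.
  (* As 0 and 1 are left ends of their intervals, [K] follows [c (g 0)] over 0 and [c (g 1)] over
     1. *)
  have lo0 : lo 0 = 0 := lo_int 0 nA0; have lo1 : lo 1 = 1 := lo_int 1 nA1.
  have := cl_lo 0 t nA0; have := cl_lo 1 t nA1; rewrite lo0 lo1 => cl1 cl0.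
  by rewrite !KN// cl0 cl1 g01.
Qed.

End fixed_path.

Lemma free_contraction : exists2 d, 0 < d & forall g : R -> X,
  (forall s, ~ A (g s) -> {for s, continuous g}) ->
  (forall s e, A (g s) -> 0 < e -> \forall t \near s, thickening A e (g t)) ->
  (forall s, thickening A d (g s)) -> g 0 = g 1 ->
  exists K : R * R -> Y,
    [/\ continuous K, (forall w, U (K w)),
        (forall s : R, 0 <= s <= 1 -> K (s, 0) = pi (g s) /\ K (s, 1) = y0) &
        (forall t : R, 0 <= t <= 1 -> K (0, t) = K (1, t))].
Proof.
have [e e_gt0 eU] := preimage_thickening oU Uy0; have e2 : 0 < e / 2 by lra.
have [c /(cell_choice cA lX lA)[S SP]] := path_to_choice cA lX.1.
have [d d_gt0 dS] := SP _ e2.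
(* Cells of radius [e / 2] around points within [e / 2] of [A] stay in the [e]-thickening, which is
   mapped into [U]. *)
exists (Num.min d (e / 2)) => [|g cg gA gd g01]; first by rewrite lt_min d_gt0.
apply: (@free_contraction_path g c S e (Num.min d (e / 2))) => //.
  by rewrite ge_min lexx orbT.
move=> p sp pd; apply: dS => //; apply: thickeningW pd; by rewrite ge_min lexx.
Qed.

End contraction.

(** * The collapse: open sets, local lifting, local path connectedness *)

Section quotient.
Local Open Scope quotient_scope.
Context {R : realType} {X : topologicalType} {I : Type} {A : I -> set X}
  (dA : trivIset [set: I] A).
Let Y := collapse dA.
Let pi : X -> Y := \pi_Y.

Lemma collapse_piP x y : pi x = pi y <-> x = y \/ exists i, A i x /\ A i y.
Proof. by split => [/eqmodP/asboolP|h] //; apply/eqmodP/asboolP. Qed.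

Lemma collapse_pi_continuous : continuous pi.
Proof. exact: pi_continuous. Qed.

Lemma collapse_open (M : set X) : open M ->
  (forall x y, pi x = pi y -> M x -> M y) -> open (pi @` M).
Proof.
move=> oM satM; change (open (pi @^-1` (pi @` M))).
suff -> : pi @^-1` (pi @` M) = M by [].
apply/seteqP; split => [x [y My yx]|x Mx]; first exact: satM My.
by exists x.
Qed.

Lemma collapse_saturated i (M : set X) : A i `<=` M ->
  (forall j, j <> i -> M `&` A j = set0) -> forall x y, pi x = pi y -> M x -> M y.
Proof.
move=> AM MA x y /collapse_piP[<-//|[j [Ax Ay]]] Mx.
have [ji|ji] := pselect (j = i); first by apply: AM; rewrite -ji.
by have : (M `&` A j) x by []; rewrite MA.
Qed.

Lemma collapse_pi_inj x y : pi x = pi y -> (forall i, ~ A i x) -> x = y.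
Proof. by move=> /collapse_piP[//|[i [Ax _]]] /(_ i). Qed.

(** Off the [A_i] the projection is injective and open, so [repr] is a continuous local inverse
    there. *)
Lemma collapse_repr_continuous (T : topologicalType) (F : T -> Y) (s : T) :
  open (~` \bigcup_i A i) ->
  {for s, continuous F} -> ~ (\bigcup_i A i) (repr (F s)) ->
  {for s, continuous (fun t => repr (F t))}.
Proof.
move=> oA cF nA B; rewrite /= nbhsE => -[B' [oB' B's] B'B].
pose M := B' `&` ~` \bigcup_i A i.
have Minj x y : M x -> pi x = pi y -> x = y.
  by move=> [_ nx] /collapse_pi_inj; apply => i Ax; apply: nx; exists i.
have oM : open (pi @` M).
  apply: collapse_open; first exact: openI.
  by move=> x y xy Mx; rewrite -(Minj x y).
have nM : nbhs (F s) (pi @` M).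
  apply: open_nbhs_nbhs; split => //; exists (repr (F s)) => //; exact: reprK.
have : \forall t \near s, (pi @` M) (F t) by exact: cF.
apply: filterS => t [x Mx xF]; apply: B'B.
by rewrite -(Minj x (repr (F t)))//; [case: Mx|rewrite xF; apply/esym/reprK].
Qed.

(** The path component of [y] in [U] is open: local path connectedness of [X] makes its preimage
    open. *)
Lemma collapse_locally_path_connected :
  locally_path_connected R X -> locally_path_connected R Y.
Proof.
move=> lX y U oU Uy.
pose V := [set z | exists f : R -> Y, total_path U y z f].
have VU : V `<=` U by move=> z [f [_ Uf _ f1]]; rewrite -(f1 1).
exists V; split => //.
- change (open (pi @^-1` V)); rewrite openE => x Vx.
  have oW : open (pi @^-1` U) by [].
  have [W [oW' Wx WU cW]] := lX x _ oW (VU _ Vx).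
  apply: filterS (open_nbhs_nbhs (conj oW' Wx)) => z Wz.
  have [f tf] := Vx; have [h /total_path_clamp [ch Wh h0 h1]] := cW x z Wx Wz.
  exists (path_cat f (fun t => pi ((h \o clamp) t))).
  apply: total_path_cat tf _; split.
  + by apply: continuous_compT ch collapse_pi_continuous.
  + by move=> t; apply: WU; exact: Wh.
  + by move=> t t0; rewrite h0.
  + by move=> t t1; rewrite h1.
- exists (cst y); split => //; exact: cst_continuous.
(* Initial pieces of a path from [y] show that the path stays in the component of [y]. *)
have toV z (f : R -> Y) : total_path U y z f -> total_path V y z f.
  move=> [cf Uf f0 f1]; split => // t; exists (fun s => f (t * clamp s)); split => //.
  + by apply: continuous_compT cf; continuity.
  + by move=> s s0; rewrite clamp_le0// mulr0 f0.
  + by move=> s s1; rewrite clamp_ge1// mulr1.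
move=> z1 z2 [f1 /toV tf1] [f2 /toV tf2].
by exists (path_cat (fun t => f1 (1 - t)) f2); apply: total_path_is_path;
  apply: total_path_cat tf2; exact: total_path_rev.
Qed.

End quotient.

(** * Local simple connectedness of the collapse *)

Section theorem.
Local Open Scope quotient_scope.
Context {R : realType} {X : metricType R} {n : nat} {A : 'I_n -> set X}
  (dA : trivIset [set: 'I_n] A).
Let Y := collapse dA.
Let pi : X -> Y := \pi_Y.
Context (lX : locally_1_connected R X) (cA : forall i, compact (A i)).

Let open_compl (P : set 'I_n) : open (~` \bigcup_(i in P) A i).
Proof.
apply: closed_openC; apply: closed_bigcup; first exact: finite_finset.
by move=> i _; exact: (compact_closed (@metric_hausdorff R X) (@cA i)).
Qed.

(** Over the complement of the [A_i], loops lift by [repr]; the nullhomotopy found in [X] is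
    projected. *)
Lemma collapse_simply_connected_off (y : Y) U : open U -> U y ->
  ~ (\bigcup_i A i) (repr y) ->
  exists V, [/\ open V, V y, V `<=` U &
      forall x (f : R -> Y), is_path V x x f -> nullhomotopic U f].
Proof.
move=> oU Uy nA.
pose N := pi @^-1` U `&` ~` \bigcup_i A i.
have oN : open N by apply: openI (open_compl _).
have Ny : N (repr y) by split => //; rewrite /pi /= reprK.
have [V [oV Vy VN sV]] := lX.2 _ _ oN Ny.
have Ninj x z : N x -> pi x = pi z -> x = z.
  by move=> [_ nx] /collapse_pi_inj; apply => i Ax; apply: nx; exists i.
exists (pi @` V); split.
- by apply: collapse_open => // x z xz Vx; rewrite -(Ninj x z) //; exact: VN.
- by exists (repr y) => //; exact: reprK.
- by move=> _ [x /VN[Ux _] <-].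
move=> x f /total_path_clamp [cf Vf f0 f1].
pose g t := repr ((f \o clamp) t).
have pig t : pi (g t) = f (clamp t) by exact: reprK.
have Vg t : V (g t).
  have [z Vz zf] := Vf t; rewrite -(Ninj z (g t))//; first exact: VN.
  by rewrite zf; apply/esym/reprK.
have tg : total_path V (repr x) (repr x) g.
  split => //.
  - move=> t; apply: collapse_repr_continuous; [exact: open_compl|exact: cf|].
    by have [] := VN _ (Vg t).
  - by move=> t t0; rewrite /g f0.
  - by move=> t t1; rewrite /g f1.
have [H [cH NH H01 Hside]] := sV _ _ (total_path_is_path tg).
exists (pi \o H); split.
- exact: (continuous_compT cH (@collapse_pi_continuous _ _ _ dA)).
- by move=> s t s01 t01; have [] := NH _ _ s01 t01.
- move=> s; rewrite in_itv /= => s01; have [-> ->] := H01 s s01.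
  by rewrite !pig clampK// clamp_le0.
- move=> t t01; rewrite /=; have [-> ->] := Hside t t01.
  by rewrite !pig clamp_le0// clamp_ge1.
Qed.

Lemma collapse_simply_connected_at (y : Y) U i : open U -> U y ->
  locally_path_connected R (A i) -> A i (repr y) ->
  exists V, [/\ open V, V y, V `<=` U &
      forall x (f : R -> Y), is_path V x x f -> nullhomotopic U f].
Proof.
move=> oU Uy lA Ay.
have piA a : A i a -> pi a = y.
  by move=> Aa; rewrite -[RHS]reprK; apply/collapse_piP; right; exists i.
have [d1 d10 contr] :=
  free_contraction (@cA i) lX lA (@collapse_pi_continuous _ _ _ dA) piA oU Uy.
(* [W] avoids the other [A_j], so the thickenings of [A_i] inside it are saturated and have open
   images. *)
pose W := pi @^-1` U `&` ~` \bigcup_(j in [set j | j <> i]) A j.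
have oW : open W by apply: openI (open_compl _).
have AW : A i `<=` W.
  move=> a Aa; split; first by rewrite /= piA.
  by move=> [j /= ji Aj]; apply: ji; apply: (dA (i := j) (j := i)) => //; exists a.
have [d2 d20 dW] := compact_thickening (@cA i) oW AW.
have satT e : 0 < e -> e <= d2 -> forall x z,
    pi x = pi z -> thickening (A i) e x -> thickening (A i) e z.
  move=> e0 ed; apply: (collapse_saturated (i := i)); first exact: subset_thickening.
  move=> j ji; rewrite -subset0 => x [/(thickeningW ed)/dW[_ nA] Aj].
  by apply: nA; exists j.
pose d := Num.min d1 d2.
have d0 : 0 < d by rewrite lt_min d10.
have dd2 : d <= d2 by rewrite ge_min lexx orbT.
exists (pi @` thickening (A i) d); split.
- by apply: collapse_open; [exact: open_thickening|exact: satT].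
- by exists (repr y); [exact: subset_thickening|exact: reprK].
- by move=> _ [x /(thickeningW dd2)/dW[Ux _] <-].
move=> x f pf; have [cf Vf f0 f1] := total_path_clamp pf.
pose g t := repr ((f \o clamp) t).
have pig t : pi (g t) = f (clamp t) by exact: reprK.
have Tg t : thickening (A i) d (g t).
  have [z Tz zf] := Vf t; apply: satT Tz => //; by rewrite pig.
have [s nAs|s e As e0|s||K [cK UK Kg K01]] := contr g.
- apply: collapse_repr_continuous; [exact: open_compl|exact: cf|].
  move=> [j _ Aj]; have [_] := dW _ (thickeningW dd2 (Tg s)); apply; exists j => //= ji.
  by apply: nAs; rewrite -ji.
(* Only thickenings of radius at most [d2] are known to be saturated, hence the truncation of
   [e]. *)
- pose e' := Num.min e d2.
  have e'0 : 0 < e' by rewrite lt_min e0.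
  have oT : open (pi @` thickening (A i) e').
    apply: collapse_open; first exact: open_thickening.
    by apply: satT => //; rewrite ge_min lexx orbT.
  have : \forall t \near s, (pi @` thickening (A i) e') ((f \o clamp) t).
    apply: cf; apply: open_nbhs_nbhs; split => //.
    by exists (g s); [exact: subset_thickening|exact: pig].
  apply: filterS => t [z Tz zf]; apply: (@thickeningW _ _ _ e'); first by rewrite ge_min lexx.
  by apply: satT Tz => //; [rewrite ge_min lexx orbT|rewrite pig].
- by apply: thickeningW (Tg s); rewrite ge_min lexx.
- by rewrite /g f0 ?f1.
(* The base point moves during the contraction [K]; conjugation by its track gives a based
   nullhomotopy. *)
apply: (nullhomotopic_free (a := y) cK UK _ K01) => s s01.
have [-> ->] := Kg s s01; split => //; rewrite -[in RHS](clampK s01); exact: pig.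
Qed.

End theorem.

Theorem theoremA (R : realType) (X : metricType R) (n : nat)
    (A : 'I_n -> set X) (disjA : trivIset [set: 'I_n] A) :
  locally_1_connected R X ->
  (forall i, connected (A i)) ->
  (forall i, locally_path_connected R (A i)) ->
  (forall i, compact (A i)) ->
  locally_1_connected R (collapse disjA).
Proof.
move=> lX _ lA cA; split; first exact: collapse_locally_path_connected lX.1.
move=> y U oU Uy; have [[i _ Ay]|nA] := pselect ((\bigcup_i A i) (repr y)).
  exact: (collapse_simply_connected_at lX cA oU Uy (lA i) Ay).
exact: collapse_simply_connected_off.
Qed.
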